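(* Let $\mathcal{S}$ be the class of unital meet semilattices. Then there exists $\mathbf{A}$ in $\mathcal{S}$ such that $b(\mathbf{A})\neq b_0(\mathbf{A})$.
   Context: A unital meet semilattice is an algebra $\langle S;\wedge,1\rangle$ with $\wedge$ an associative, commutative, idempotent binary operation having $1$ as identity element (so $1$ is the top element); homomorphisms preserve $\wedge$ and $1$. All compact spaces are assumed Hausdorff. $\mathcal{S}^{\mathrm{ct}}$ is the category of compact topological unital meet semilattices ($\wedge$ jointly continuous) with continuous homomorphisms; $\mathcal{S}^{\mathrm{Bt}}$ is its full subcategory of those whose topology is zero-dimensional (has a basis of clopen sets). $\mathbf{B}^\flat$ is $\mathbf{B}$ with its topology forgotten. The Bohr compactification $b(\mathbf{A})\in\mathcal{S}^{\mathrm{ct}}$ of $\mathbf{A}\in\mathcal{S}$ comes with an embedding $\iota_{\mathbf{A}}\colon\mathbf{A}\to b(\mathbf{A})^\flat$ with dense image, and is characterised up to isomorphism by: for every $\mathbf{B}\in\mathcal{S}^{\mathrm{ct}}$ and homomorphism $g\colon\mathbf{A}\to\mathbf{B}^\flat$ there is a unique continuous homomorphism $h\colon b(\mathbf{A})\to\mathbf{B}$ with $h\circ\iota_{\mathbf{A}}=g$. The zero-dimensional Bohr compactification $b_0(\mathbf{A})\in\mathcal{S}^{\mathrm{Bt}}$ is defined in the same way with $\mathcal{S}^{\mathrm{Bt}}$ in place of $\mathcal{S}^{\mathrm{ct}}$. Equality of $b(\mathbf{A})$ and $b_0(\mathbf{A})$ means isomorphism of topological semilattices commuting with the canonical embeddings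 of $\mathbf{A}$ (equivalently, $b(\mathbf{A})\in\mathcal{S}^{\mathrm{Bt}}$). *)

(* Defs.v *)
From HB Require Import structures.
From mathcomp Require Import all_boot all_classical.
From mathcomp Require Import topology.

Set Implicit Arguments.
Unset Strict Implicit.
Unset Printing Implicit Defensive.

Local Open Scope classical_set_scope.

(* The library's tMeetSemilatticeType cannot be used as the algebraic layer:
   Hierarchy Builder already takes order_topology's OrderNbhs as the join of
   Order.MeetSemilattice and Nbhs, so no topological structure on a meet
   semilattice that is not a chain can be declared on top of the two. *)
HB.mixin Record isUnitalMeetSemilattice S := {
  smeet : S -> S -> S;
  sone : S;
  smeetA : associative smeet;
  smeetC : commutative smeet;
  smeetxx : idempotent_op smeet;
  smeet1x : left_id sone smeet
}.

#[short(type="unitalMeetSemilatticeType")]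
HB.structure Definition UnitalMeetSemilattice :=
  {S of isUnitalMeetSemilattice S}.

Arguments sone {s}.

HB.structure Definition PreTopologicalSemilattice :=
  {S of Topological S & UnitalMeetSemilattice S}.

HB.mixin Record PreTopologicalSemilattice_isTopologicalSemilattice S
    & PreTopologicalSemilattice S := {
  smeet_continuous : continuous (fun p : S * S => smeet p.1 p.2)
}.

#[short(type="topologicalSemilatticeType")]
HB.structure Definition TopologicalSemilattice :=
  {S of PreTopologicalSemilattice S
      & PreTopologicalSemilattice_isTopologicalSemilattice S}.

Definition semilattice_hom (S T : unitalMeetSemilatticeType) (f : S -> T) :
    Prop :=
  {morph f : x y / smeet x y} /\ f sone = sone.

(* The object classes of the categories S^ct and S^Bt. The library's
   [zero_dimensional] only asks that clopen sets separate points, hence the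
   explicit clopen basis. *)
Definition Sct (S : topologicalSemilatticeType) : Prop :=
  compact [set: S] /\ hausdorff_space S.

Definition SBt (S : topologicalSemilatticeType) : Prop :=
  Sct S /\ basis [set U : set S | clopen U].

Definition universal_compactification (C : topologicalSemilatticeType -> Prop)
    (A : unitalMeetSemilatticeType) (K : topologicalSemilatticeType)
    (iota : A -> K) : Prop :=
  [/\ C K,
      semilattice_hom iota /\ injective iota,
      dense (range iota)
    & forall B : topologicalSemilatticeType, C B ->
      forall g : A -> B, semilattice_hom g ->
      exists! h : K -> B,
        [/\ continuous h, semilattice_hom h & h \o iota = g]].

Definition bohr_compactification (A : unitalMeetSemilatticeType)
    (K : topologicalSemilatticeType) (iota : A -> K) : Prop :=
  universal_compactification Sct iota.

Definition zero_dim_bohr_compactification (A : unitalMeetSemilatticeType)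
    (K : topologicalSemilatticeType) (iota : A -> K) : Prop :=
  universal_compactification SBt iota.

Definition isomorphic_under (A : unitalMeetSemilatticeType)
    (K L : topologicalSemilatticeType) (iota : A -> K) (kappa : A -> L) :
    Prop :=
  exists (h : K -> L) (k : L -> K),
    [/\ continuous h /\ semilattice_hom h,
        continuous k /\ semilattice_hom k,
        cancel h k /\ cancel k h
      & h \o iota = kappa].

(* Main.v *)
(** A point of a compact semilattice in which [A] is dense is determined by the
    subsets of [A] accumulating at it.  Hence these semilattices form, up to
    isomorphism, a small family, and both compactifications exist as the
    closure of [A] in a product.

    Let [K] be the set of pairs [(a, c)] with [a n] a subset of a set with
    [2 ^ n] points and [0 <= c <= h_n (a n)], where
    [h_n s = 1 - log (|s| + 1) / (n + 1)] (logarithm rounded up to an integer).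
    Union in the first component and [min (c, d, inf_n h_n (a n U b n))] in the
    second make [K] a semilattice.  Doubling the cardinality of a set changes
    [h_n] by at most [1 / (n + 1)], so that the infimum is a uniform limit of
    continuous functions of [(a, c)] and [(b, d)], and [K] is a compact
    topological semilattice.  The singletons of layer [n] tend to [1] with [n],
    while the meet of all the singletons of one layer has height [0]: [K] does
    not have small semilattices at [1].  A continuous image of a
    zero-dimensional compact semilattice does, so the identity of [K] does not
    extend to [b_0(K)], although it extends to [b(K)]. *)

From HB Require Import structures.
Require Import Defs.
From mathcomp Require Import all_boot all_order all_algebra all_classical.
From mathcomp Require Import reals topology interval_inference normedtype.
From mathcomp Require Import Rstruct lra.

Set Implicit Arguments.
Unset Strict Implicit.
Unset Printing Implicit Defensive.
Import Order.TTheory GRing.Theory Num.Theory numFieldNormedType.Exports.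

Local Open Scope classical_set_scope.

(** * Topological preliminaries *)

Lemma hausdorff_prod (X Y : topologicalType) :
  hausdorff_space X -> hausdorff_space Y -> hausdorff_space (X * Y)%type.
Proof.
move=> hX hY [x y] [x' y'] pq; congr pair; [apply: hX|apply: hY] => A B nA nB.
  by have [[u v] /= []] := pq _ _ (cvg_fst nA) (cvg_fst nB); exists u.
by have [[u v] /= []] := pq _ _ (cvg_snd nA) (cvg_snd nB); exists v.
Qed.

Lemma continuous_fst (X Y Z : topologicalType) (f : X -> Z) :
  continuous f -> continuous (fun p : X * Y => f p.1).
Proof. by move=> cf p; apply: (cvg_comp fst f); [exact: cvg_fst|exact: cf]. Qed.

Lemma continuous_snd (X Y Z : topologicalType) (f : Y -> Z) :
  continuous f -> continuous (fun p : X * Y => f p.2).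
Proof. by move=> cf p; apply: (cvg_comp snd f); [exact: cvg_snd|exact: cf]. Qed.

Lemma closed_equalizer (X Y : topologicalType) (f g : X -> Y) :
  hausdorff_space Y -> continuous f -> continuous g ->
  closed [set x | f x = g x].
Proof.
move=> hY cf cg x clx; apply: hY => A B nA nB.
have nfA : nbhs x (f @^-1` A) := cf x A nA.
have ngB : nbhs x (g @^-1` B) := cg x B nB.
have [z [fgz [Az Bz]]] := clx _ (filterI nfA ngB).
by exists (f z); split => //; rewrite fgz.
Qed.

Lemma continuous_dense_eq (X Y : topologicalType) (D : set X) (h k : X -> Y) :
  dense D -> hausdorff_space Y -> continuous h -> continuous k ->
  (forall x, D x -> h x = k x) -> h = k.
Proof.
rewrite open_hausdorff => dD hY /continuousP ch /continuousP ck hk.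
apply/funext => x; apply: contrapT => /eqP /hY[[U V]] /=.
move=> [/set_mem Ux /set_mem Vx] [oU oV /eqP UV0].
have UVx : (h @^-1` U `&` k @^-1` V) !=set0 by exists x.
have [z [[Uz Vz] Dz]] := dD _ UVx (openI (ch _ oU) (ck _ oV)).
have : (U `&` V) (h z) by split=> //; rewrite hk.
by rewrite UV0.
Qed.

(** A cluster point of the image filter lies in the range, and it pulls back because the open sets
    of [Y] are preimages. *)
Lemma initial_compact (Y : choiceType) (T : topologicalType) (f : Y -> T) :
  compact (range f) -> compact [set: initial_topology f].
Proof.
move=> cf F PF _.
have PfF : ProperFilter (f @ F) by exact: fmap_proper_filter.
have fFr : (f @ F) (range f).
  by apply: (@filterS _ F _ setT) => [y _|]; [exists y|exact: filterT].
have [t [[y _ yt] cy]] := cf (f @ F) PfF fFr; rewrite -yt in cy.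
exists y; split=> // A B FA [_ [[O oO <-] Oy OB]].
have FfA : (f @ F) (f @` A) by apply: (@filterS _ F _ A) => // z Az; exists z.
have [u [[z Az zu] Oz]] := cy _ _ FfA (open_nbhs_nbhs (conj oO Oy)).
rewrite -zu in Oz; by exists z; split=> //; exact: OB.
Qed.

Lemma initial_hausdorff (Y : choiceType) (T : topologicalType) (f : Y -> T) :
  injective f -> hausdorff_space T -> hausdorff_space (initial_topology f).
Proof.
move=> finj hT p q pq; apply/finj/hT => A B.
move=> /(initial_continuous (f := f)) Ap /(initial_continuous (f := f)) Bq.
by have [z [Az Bz]] := pq _ _ Ap Bq; exists (f z).
Qed.

Lemma initial_clopen_basis (Y : choiceType) (T : topologicalType)
    (f : Y -> T) :
  basis [set U : set T | clopen U] ->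
  basis [set U : set (initial_topology f) | clopen U].
Proof.
case=> _ bT; split=> [U [] //|y A [_ [[O oO <-] Oy OA]]].
have [U [cU Uy] UO] := bT (f y) O (open_nbhs_nbhs (conj oO Oy)).
exists (f @^-1` U) => [|z Uz]; last exact/OA/UO.
by split=> //; apply: preimage_clopen => //; exact: initial_continuous.
Qed.

Lemma cvg_initial (Y : choiceType) (T : topologicalType) (f : Y -> T)
    (I : Type) (F : set_system I) (u : I -> initial_topology f)
    (y : initial_topology f) : Filter F ->
  (fun i => f (u i)) @ F --> f y -> u @ F --> y.
Proof.
move=> FF fu A [_ [[O oO <-] Oy OA]].
have FO : F [set i | O (f (u i))] := fu O (open_nbhs_nbhs (conj oO Oy)).
by apply: (@filterS _ F FF _ _ _ FO) => i Oi; exact: OA.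
Qed.

Lemma prod_cvg (I : Type) (T : I -> topologicalType)
    (F : set_system (prod_topology T)) (x : prod_topology T) :
  Filter F -> (forall i, (fun y => y i) @ F --> x i) -> F --> x.
Proof.
move=> FF Fx; apply/cvg_sup => i A [_ [[O oO <-] Oxi OA]].
by apply: filterS OA _; exact/Fx/open_nbhs_nbhs.
Qed.

Lemma clopen_basis_zero_dimensional (T : topologicalType) :
  hausdorff_space T -> basis [set U : set T | clopen U] -> zero_dimensional T.
Proof.
move=> hT [_ bT] x y xy.
have [B [oB /set_mem Bx /set_mem nBy]] := hausdorff_accessible hT xy.
have [U [cU Ux] UB] := bT x B (open_nbhs_nbhs (conj oB Bx)).
by exists U; split=> // /UB.
Qed.

(** * Subsemilattices and products *)

Lemma continuous_smeet (X : topologicalType) (T : topologicalSemilatticeType)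
    (f g : X -> T) :
  continuous f -> continuous g -> continuous (fun x => smeet (f x) (g x)).
Proof.
move=> cf cg x.
apply: (cvg_comp (fun x => (f x, g x)) (fun q : T * T => smeet q.1 q.2)).
  exact: (cvg_pair (cf x) (cg x)).
exact: (smeet_continuous (f x, g x)).
Qed.

(** [Y] carries no operations of its own: closure of the image together with injectivity determines
    them, so a mere set of codes can receive the structure. *)
Record semilattice_embedding (Y : choiceType)
    (T : topologicalSemilatticeType) :=
  SemilatticeEmbedding {
    emb :> Y -> T;
    emb_inj : injective emb;
    emb_meet : forall x y, exists z, emb z = smeet (emb x) (emb y);
    emb_one : exists z, emb z = sone }.

Section SubSemilattice.
Context {Y : choiceType} {T : topologicalSemilatticeType}.
Variable e : semilattice_embedding Y T.

Definition subsemilattice : Type := initial_topology e.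
HB.instance Definition _ :=
  Topological.copy subsemilattice (initial_topology e).

Definition sub_meet (x y : subsemilattice) : subsemilattice :=
  projT1 (cid (emb_meet e x y)).
Definition sub_one : subsemilattice := projT1 (cid (emb_one e)).

Lemma emb_sub_meet x y : e (sub_meet x y) = smeet (e x) (e y).
Proof. by rewrite /sub_meet; case: cid. Qed.

Lemma emb_sub_one : e sub_one = sone.
Proof. by rewrite /sub_one; case: cid. Qed.

Fact sub_meetA : associative sub_meet.
Proof.
by move=> x y z; apply: (emb_inj (s:=e)); rewrite !emb_sub_meet smeetA.
Qed.
Fact sub_meetC : commutative sub_meet.
Proof.
by move=> x y; apply: (emb_inj (s:=e)); rewrite !emb_sub_meet smeetC.
Qed.
Fact sub_meetxx : idempotent_op sub_meet.
Proof. by move=> x; apply: (emb_inj (s:=e)); rewrite emb_sub_meet smeetxx. Qed.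
Fact sub_meet1x : left_id sub_one sub_meet.
Proof.
by move=> x; apply: (emb_inj (s:=e)); rewrite emb_sub_meet emb_sub_one smeet1x.
Qed.

HB.instance Definition _ := isUnitalMeetSemilattice.Build subsemilattice
  sub_meetA sub_meetC sub_meetxx sub_meet1x.

Fact sub_smeet_continuous :
  continuous (fun p : subsemilattice * subsemilattice => smeet p.1 p.2).
Proof.
apply: continuous_comp_initial.
rewrite (_ : _ \o _ = fun q => smeet (e q.1) (e q.2)); last first.
  by apply/funext => q /=; rewrite -emb_sub_meet.
by apply: continuous_smeet; [apply: continuous_fst|apply: continuous_snd];
  exact: (@initial_continuous _ _ e).
Qed.

HB.instance Definition _ :=
  PreTopologicalSemilattice_isTopologicalSemilattice.Build subsemilattice
    sub_smeet_continuous.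

Lemma emb_hom : semilattice_hom (e : subsemilattice -> T).
Proof. by split=> [x y|]; [exact: emb_sub_meet|exact: emb_sub_one]. Qed.

Lemma Sct_sub : Sct T -> closed (range e) -> Sct subsemilattice.
Proof.
move=> [cT hT] clo; split.
  exact: initial_compact (subclosed_compact clo cT _).
by apply: initial_hausdorff => //; exact: emb_inj.
Qed.

Lemma SBt_sub : SBt T -> closed (range e) -> SBt subsemilattice.
Proof.
by move=> [? bT] ?; split; [exact: Sct_sub|exact: initial_clopen_basis].
Qed.

End SubSemilattice.

Section ProdSemilattice.
Context {I : Type}.
Variable T : I -> topologicalSemilatticeType.

Definition prod_semilattice : Type := prod_topology T.
HB.instance Definition _ := Topological.copy prod_semilattice (prod_topology T).

Definition prod_meet (x y : prod_semilattice) : prod_semilattice :=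
  fun i => smeet (x i) (y i).
Definition prod_one : prod_semilattice := fun=> sone.

Fact prod_meetA : associative prod_meet.
Proof.
by move=> x y z; apply: functional_extensionality_dep => i; exact: smeetA.
Qed.
Fact prod_meetC : commutative prod_meet.
Proof.
by move=> x y; apply: functional_extensionality_dep => i; exact: smeetC.
Qed.
Fact prod_meetxx : idempotent_op prod_meet.
Proof.
by move=> x; apply: functional_extensionality_dep => i; exact: smeetxx.
Qed.
Fact prod_meet1x : left_id prod_one prod_meet.
Proof.
by move=> x; apply: functional_extensionality_dep => i; exact: smeet1x.
Qed.

HB.instance Definition _ := isUnitalMeetSemilattice.Build prod_semilattice
  prod_meetA prod_meetC prod_meetxx prod_meet1x.

Lemma prod_proj_continuous i : continuous (fun x : prod_semilattice => x i).
Proof. exact: (@proj_continuous {classic I} T i). Qed.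

Fact prod_smeet_continuous :
  continuous (fun p : prod_semilattice * prod_semilattice => smeet p.1 p.2).
Proof.
move=> p; apply: prod_cvg => i; move: p.
by apply: continuous_smeet;
  [apply: (continuous_fst (f := (fun x : prod_semilattice => x i)))|
   apply: (continuous_snd (f := (fun x : prod_semilattice => x i)))];
  exact: prod_proj_continuous.
Qed.

HB.instance Definition _ :=
  PreTopologicalSemilattice_isTopologicalSemilattice.Build prod_semilattice
    prod_smeet_continuous.

Lemma Sct_prod : (forall i, Sct (T i)) -> Sct prod_semilattice.
Proof.
move=> sT; split; last first.
  by apply: (@hausdorff_product {classic I} T) => i; case: (sT i).
rewrite (_ : [set: _] = [set f : forall i, T i | forall i, [set: T i] (f i)]).
  by apply: (@tychonoff {classic I} T (fun=> setT)) => i; case: (sT i).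
by apply/seteqP; split.
Qed.

Lemma SBt_prod : (forall i, SBt (T i)) -> SBt prod_semilattice.
Proof.
move=> sT; have sctP : Sct prod_semilattice.
  by apply: Sct_prod => i; case: (sT i).
split=> //; split=> [U [] //|x].
(* In a compact Hausdorff space, separation of points by clopen sets, which passes to products,
   already yields a clopen basis. *)
rewrite (_ : [set U | _] = [set D | D x /\ clopen D]).
  apply: zero_dimensional_cvg; [by case: sctP| |by case: sctP].
  apply: (@zero_dimension_prod {classic I} T) => i.
  by case: (sT i) => -[_ ?] ?; exact: clopen_basis_zero_dimensional.
by apply/seteqP; split=> D [].
Qed.

End ProdSemilattice.

(** * Existence of the compactifications *)

Definition productive (C : topologicalSemilatticeType -> Prop) :=
  forall (I : Type) (T : I -> topologicalSemilatticeType),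
    (forall i, C (T i)) -> C (prod_semilattice T).

Definition hereditary (C : topologicalSemilatticeType -> Prop) :=
  forall (Y : choiceType) (T : topologicalSemilatticeType)
    (e : semilattice_embedding Y T),
    C T -> closed (range e) -> C (subsemilattice e).

Section SetEmbedding.
Context (T : topologicalSemilatticeType) (E : set T).
Hypothesis EM : forall x y, E x -> E y -> E (smeet x y).
Hypothesis E1 : E sone.

Fact set_embedding_meet (x y : set_type E) :
  exists z : set_type E, val z = smeet (val x) (val y).
Proof. by exists (SigSub (mem_set (EM (set_valP x) (set_valP y)))). Qed.

Fact set_embedding_one : exists z : set_type E, val z = sone.
Proof. by exists (SigSub (mem_set E1)). Qed.

Definition set_embedding : semilattice_embedding (set_type E) T :=
  SemilatticeEmbedding val_inj set_embedding_meet set_embedding_one.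
End SetEmbedding.

Lemma closure_smeet (T : topologicalSemilatticeType) (E : set T) :
  (forall x y, E x -> E y -> E (smeet x y)) ->
  forall x y, closure E x -> closure E y -> closure E (smeet x y).
Proof.
move=> EM x y cx cy B /(smeet_continuous (x, y)) [[P Q] /= [Px Qy] PQB].
have [u [Eu Pu]] := cx P Px; have [v [Ev Qv]] := cy Q Qy.
by exists (smeet u v); split; [exact: EM|exact: (PQB (u, v))].
Qed.

Lemma closure_range_hom (A : unitalMeetSemilatticeType)
    (T : topologicalSemilatticeType) (g : A -> T) : semilattice_hom g ->
  (forall x y, closure (range g) x -> closure (range g) y ->
     closure (range g) (smeet x y)) /\ closure (range g) sone.
Proof.
move=> [gM g1]; split; last by apply: subset_closure; exists sone.
apply: closure_smeet => _ _ [a _ <-] [b _ <-].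
by exists (smeet a b) => //; rewrite gM.
Qed.

(* A compact Hausdorff semilattice generated by [A] embeds as a set in
   [set (set A)]; indexing the product by the structures on subsets of that type
   avoids the universe inconsistency of a product over all semilattices. *)
Record small_compactification (C : topologicalSemilatticeType -> Prop)
    (A : unitalMeetSemilatticeType) := {
  sc_points : set (set (set A));
  sc_structure : TopologicalSemilattice.axioms_ (set_type sc_points);
  sc_space := TopologicalSemilattice.Pack sc_structure;
  sc_map : A -> sc_space;
  sc_in : C sc_space;
  sc_hom : semilattice_hom sc_map }.

Section Universal.
Variable C : topologicalSemilatticeType -> Prop.
Hypothesis Cprod : productive C.
Hypothesis Csub : hereditary C.
Hypothesis C_Sct : forall T, C T -> Sct T.
Variable A : unitalMeetSemilatticeType.

Let J := small_compactification C A.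

(** The closure [E] of the image of [g] is coded by elements of [set (set A)], and its structure is
    transported to the set of codes. *)
Lemma small_factor (B : topologicalSemilatticeType) (g : A -> B) :
  C B -> semilattice_hom g ->
  exists (j : J) (f : sc_space j -> B),
    [/\ continuous f, semilattice_hom f & f \o sc_map j = g].
Proof.
move=> CB hg; have [cB hB] := C_Sct CB.
have [EM E1] := closure_range_hom hg; set E := closure (range g) in EM E1.
have gE a : E (g a) by apply: subset_closure; exists a.
pose tau (b : B) : set (set A) := [set S | closure (g @` S) b].
(* For disjoint open [U] around [b] and [V] around [b'], the set of [a] with [g a] in [U] belongs to
   the code of [b] but not to that of [b']. *)
have tau_inj b b' : E b -> tau b = tau b' -> b = b'.
  move=> Eb tbb'; apply: contrapT => /eqP bb'.
  move: hB; rewrite open_hausdorff => /(_ _ _ bb').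
  move=> [[U V]] /= [/set_mem Ub /set_mem Vb'] [oU oV /eqP UV0].
  have : tau b (g @^-1` U).
    move=> W Wb; have [_ [[a _ <-] [Wa Ua]]] :=
      Eb _ (filterI Wb (open_nbhs_nbhs (conj oU Ub))).
    by exists (g a); split=> //; exists a.
  rewrite tbb' => /(_ V (open_nbhs_nbhs (conj oV Vb'))) [_ [[a Ua <-] Va]].
  by have : (U `&` V) (g a) by []; rewrite UV0.
have /choice[f fP] :
    forall x : set_type (tau @` E), exists b, E b /\ tau b = val x.
  move=> x; by have [b Eb bx] := set_valP x; exists b.
have f_inj : injective f.
  by move=> x y fxy; apply: val_inj; rewrite -(fP x).2 fxy (fP y).2.
have f_tau b (Eb : E b) : exists x, f x = b.
  have Db : (tau @` E) (tau b) by exists b.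
  exists (SigSub (mem_set Db)).
  by apply: tau_inj; [exact: (fP _).1|rewrite (fP _).2].
have fM x y : exists z, f z = smeet (f x) (f y).
  by apply: f_tau; apply: EM; exact: (fP _).1.
pose e := SemilatticeEmbedding f_inj fM (f_tau _ E1).
have Ce : C (subsemilattice e).
  apply: Csub => //.
  rewrite (_ : range e = E); first exact: closed_closure.
  apply/seteqP; split=> [_ [x _ <-]|b /(f_tau b)[x xb]]; last by exists x.
  by case: (fP x).
have /choice[gt gtP] : forall a, exists x : subsemilattice e, e x = g a.
  move=> a; exact: (f_tau (g a) (gE a)).
have hgt : semilattice_hom gt.
  split=> [a b|]; apply: (emb_inj (s:=e)).
    by rewrite (emb_hom e).1 !gtP hg.1.
  by rewrite (emb_hom e).2 gtP hg.2.
exists (Build_small_compactification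
  (sc_structure := TopologicalSemilattice.class (subsemilattice e)) Ce hgt).
exists f; split.
- exact: (@initial_continuous _ _ e).
- exact: (emb_hom e).
- by apply/funext.
Qed.

Let P := prod_semilattice (fun j : J => sc_space j).
Let pi (a : A) : P := fun j => sc_map j a.

Let pi_hom : semilattice_hom pi.
Proof.
split=> [a b|]; apply: functional_extensionality_dep => j.
  exact: (sc_hom j).1.
exact: (sc_hom j).2.
Qed.

Let E := closure (range pi).

Let E_emb : semilattice_embedding (set_type E) P :=
  set_embedding (closure_range_hom pi_hom).1 (closure_range_hom pi_hom).2.

(** Every [g] factors through some small compactification, so it extends by a coordinate projection.
    Density gives uniqueness, and separation of points makes [iota] injective. *)
Theorem universal_compactification_exists :
  (forall a b : A, a <> b ->
    exists (B : topologicalSemilatticeType) (g : A -> B),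
    [/\ C B, semilattice_hom g & g a <> g b]) ->
  exists (K : topologicalSemilatticeType) (iota : A -> K),
    universal_compactification C iota.
Proof.
move=> sepA.
have piE a : E (pi a) by apply: subset_closure; exists a.
pose K := subsemilattice E_emb.
pose iota (a : A) : K := SigSub (mem_set (piE a)).
have hiota : semilattice_hom iota.
  split=> [a b|]; apply: (emb_inj (s:=E_emb)).
    rewrite (emb_hom E_emb).1; exact: (pi_hom.1 a b).
  by rewrite (emb_hom E_emb).2; exact: pi_hom.2.
have diota : dense (range iota).
  move=> V [x Vx] [O oO OV]; have Ox : O (val x) by rewrite -OV in Vx.
  have [y [[a _ ya] Oy]] := set_valP x _ (open_nbhs_nbhs (conj oO Ox)).
  rewrite -ya in Oy; exists (iota a); split; last by exists a.
  by rewrite -OV.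
have ext B : C B -> forall g : A -> B, semilattice_hom g ->
    exists h : K -> B, [/\ continuous h, semilattice_hom h & h \o iota = g].
  move=> CB g hg; have [j [f [cf hf fg]]] := small_factor CB hg.
  exists (fun x => f (E_emb x j)); split.
  - move=> x; apply: (cvg_comp (fun x : K => E_emb x j) f); last exact: cf.
    apply: (cvg_comp E_emb (fun y : P => y j)).
      exact: (@initial_continuous _ _ E_emb).
    exact: (@prod_proj_continuous _ _ j).
  - split=> [x y|].
      by rewrite -hf.1 (emb_hom E_emb).1.
    by rewrite (emb_hom E_emb).2 -hf.2.
  - by rewrite -fg; apply/funext.
exists K, iota; split.
- apply: Csub; first by apply: Cprod => j; exact: sc_in.
  rewrite (_ : range _ = E); first exact: closed_closure.
  apply/seteqP; split=> [_ [x _ <-]|x Ex]; first exact: set_valP.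
  by exists (SigSub (mem_set Ex)).
- split=> // a b iab; apply: contrapT => /sepA[B [g [CB hg]]]; apply.
  by have [h [_ _ <-]] := ext B CB g hg; rewrite /= iab.
- by [].
- move=> B CB g hg; have [h [ch hh hg']] := ext B CB g hg.
  exists h; split=> // h' [ch' hh' hg''].
  apply: (continuous_dense_eq diota) => //; first by have [] := C_Sct CB.
  by move=> _ [a _ <-]; rewrite -[LHS]/((h \o _) a) hg' -hg''.
Qed.

End Universal.

(** * The two-element semilattice separates points *)

Fact andb_continuous : continuous (fun p : bool * bool => p.1 && p.2).
Proof.
move=> p A; rewrite nbhs_principalE => /principal_filterP Ap.
exists ([set p.1], [set p.2]) => /= [|q [/= -> ->]] //.
by split; rewrite nbhs_principalE; apply/principal_filterP.
Qed.

HB.instance Definition _ :=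
  isUnitalMeetSemilattice.Build bool andbA andbC andbb andTb.
HB.instance Definition _ :=
  PreTopologicalSemilattice_isTopologicalSemilattice.Build bool andb_continuous.

Lemma SBt_bool : SBt bool.
Proof.
split; first by split; [exact: bool_compact|exact: discrete_hausdorff].
split=> [U []//|x A]; rewrite nbhs_principalE => /principal_filterP Ax.
exists [set x] => [|_ ->//]; split=> //.
by split; [exact: discrete_open|exact: discrete_closed].
Qed.

(** The characteristic function of a principal filter is a homomorphism. If [a] is below [b], the
    filter of [b] omits [a]; otherwise the filter of [a] omits [b]. *)
Lemma bool_separates (A : unitalMeetSemilatticeType) (a b : A) : a <> b ->
  exists g : A -> bool, semilattice_hom g /\ g a <> g b.
Proof.
pose up (a x : A) := `[< smeet a x = a >].
have up_hom c : semilattice_hom (up c).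
  split=> [x y|]; last by apply/asboolP; rewrite smeetC smeet1x.
  apply/asboolP/andP => [cxy|[/asboolP cx /asboolP cy]]; last first.
    by rewrite smeetA cx cy.
  split; apply/asboolP; rewrite -[in LHS]cxy.
    by rewrite [smeet x y]smeetC -!smeetA smeetxx [smeet y x]smeetC.
  by rewrite -!smeetA smeetxx.
move=> ab; case: (pselect (smeet a b = a)) => [aba|naba].
  exists (up b); split=> //; rewrite /up smeetxx; move=> baE.
  have /asboolP bab : `[< smeet b a = b >] by rewrite baE; exact/asboolP.
  by apply: ab; rewrite -aba smeetC.
exists (up a); split=> //; rewrite /up smeetxx => abE; apply: naba.
by apply/asboolP; rewrite -abE; exact/asboolP.
Qed.

Lemma bohr_exists (A : unitalMeetSemilatticeType) :
  exists (K : topologicalSemilatticeType) (iota : A -> K),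
    bohr_compactification iota.
Proof.
apply: universal_compactification_exists => [I T|Y T e|//|a b ab].
- exact: Sct_prod.
- exact: Sct_sub.
- have [g [hg gab]] := bool_separates ab.
  by exists bool, g; split=> //; exact: SBt_bool.1.
Qed.

Lemma zero_dim_bohr_exists (A : unitalMeetSemilatticeType) :
  exists (K : topologicalSemilatticeType) (iota : A -> K),
    zero_dim_bohr_compactification iota.
Proof.
apply: universal_compactification_exists => [I T|Y T e|T []//|a b ab].
- exact: SBt_prod.
- exact: SBt_sub.
- have [g [hg gab]] := bool_separates ab.
  by exists bool, g; split=> //; exact: SBt_bool.
Qed.

(** * Small semilattices in the zero-dimensional case *)

(** The parts [D c] of [C] below its elements [c] form a filter base, as [D (smeet a b)] lies in
    [D a] and [D b]. A cluster point lies in every [D c], these being closed. *)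
Lemma Sct_least (T : topologicalSemilatticeType) (C : set T) : Sct T ->
  closed C -> C !=set0 -> (forall x y, C x -> C y -> C (smeet x y)) ->
  exists2 e, C e & forall c, C c -> smeet e c = e.
Proof.
move=> [cT hT] clC [c0 C0] CM.
pose D c := C `&` [set x | smeet x c = x].
have FF : ProperFilter (filter_from C D).
  apply: filter_from_proper => [|c Cc]; last first.
    by exists c; split=> //; exact: smeetxx.
  apply: filter_from_filter; first by exists c0.
  move=> a b Ca Cb; exists (smeet a b); first exact: CM.
  move=> x [Cx xab]; split; split=> //=; rewrite -xab.
    by rewrite [smeet a b]smeetC -!smeetA smeetxx.
  by rewrite -!smeetA smeetxx.
have [|e [_ eF]] := cT _ FF; first exact: filterT.
have De c : C c -> D c e.
  move=> Cc; have clD : closed (D c).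
    apply: closedI => //; apply: closed_equalizer => //.
      by apply: continuous_smeet => [x|x]; [exact: cvg_id|exact: cvg_cst].
    by move=> x; exact: cvg_id.
  by apply: clD; move: eF; rewrite clusterE; apply; exists c.
by exists e => [|c /De[]]; first by case: (De _ C0).
Qed.

(* [W] is the set of [x] whose translation maps the part of [V] below [e] into
   [V], for a clopen neighbourhood [V] of [e] contained in [U]. *)
Lemma SBt_small_submonoid (T : topologicalSemilatticeType) (C U : set T)
    (e : T) :
  SBt T -> C e -> (forall c, C c -> smeet e c = e) -> nbhs e U ->
  exists W : set T, [/\ forall c, C c -> nbhs c W,
    forall x y, W x -> W y -> W (smeet x y) &
    forall x, W x -> U (smeet x e)].
Proof.
move=> [[cT hT] [_ bT]] Ce eC /bT[V [[oV cV] Ve] VU].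
pose W : set T := [set x | forall u, V u -> smeet u e = u -> V (smeet x u)].
exists W; split=> [c Cc|x y Wx Wy u Vu ue|x Wx]; last first.
- by apply: VU; apply: Wx => //; exact: smeetxx.
- rewrite -smeetA; apply: Wx; first exact: Wy.
  by rewrite -smeetA ue.
(* Tube argument: [c] fixes every [u] below [e], so translation by [x] near [c] keeps [u] in [V],
   uniformly over the compact set [Q]. *)
pose Q := V `&` [set u | smeet u e = u].
have cQ : compact Q.
  apply: (subclosed_compact _ cT) => //; apply: closedI => //.
  apply: closed_equalizer => //.
    by apply: continuous_smeet => [x|x]; [exact: cvg_id|exact: cvg_cst].
  by move=> x; exact: cvg_id.
have /compact_near_coveringP ncQ := cQ.
have : \forall x \near c, Q `<=` (fun u => V (smeet x u)).
  apply: ncQ => u [Vu ue].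
  have cu : smeet u c = u by rewrite -{1}ue -smeetA eC.
  have VV : nbhs (smeet u c) V by rewrite cu; exact: open_nbhs_nbhs.
  have [[A B] /= [nA nB] AB] := smeet_continuous (u, c) V VV.
  by exists (A, B) => // -[v x] /= [Av Bx]; rewrite smeetC; exact: (AB (v, x)).
by apply: filterS => x Wx u Vu ue; exact: Wx.
Qed.

(** * A compact semilattice without small semilattices *)

(** The successor of the cardinality of a union is at most the sum of the two successors, hence at
    most twice the larger power of two. *)
Lemma up_log2_setU (T : finType) (s t : {set T}) :
  (up_log 2 #|s :|: t|.+1 <= (maxn (up_log 2 #|s|.+1) (up_log 2 #|t|.+1)).+1)%N.
Proof.
apply: up_log_min => //; rewrite expnS mul2n -addnn.
have cU : (#|s :|: t| < #|s|.+1 + #|t|.+1)%N.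
  by rewrite cardsU addSn addnS ltnS leqW // leq_subr.
apply: leq_trans cU _; apply: leq_add; apply: leq_trans (up_logP _ (ltnSn 1)) _;
  by rewrite leq_exp2l // ?leq_maxl ?leq_maxr.
Qed.

Local Open Scope ring_scope.

Section NonLawson.
Variable R : realType.

Definition layer (n : nat) := {set 'I_(2 ^ n)}.

(** Adding one to the cardinality gives the empty set height 1. As [n.+1] is the rounded logarithm
    of [2 ^ n + 1], the full layer has height exactly 0. *)
Definition height n (s : layer n) : R :=
  1 - (up_log 2 #|s|.+1)%:R / n.+1%:R.

Lemma height_le n (s : layer n) k :
  (up_log 2 #|s|.+1 <= k)%N -> 1 - k%:R / n.+1%:R <= height s.
Proof. by move=> sk; rewrite lerB // ler_pM2r ?invr_gt0 ?ltr0n // ler_nat. Qed.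

Lemma height_ge0 n (s : layer n) : 0 <= height s.
Proof.
rewrite subr_ge0 ler_pdivrMr ?ltr0n // mul1r ler_nat up_log_min //.
rewrite expnS mul2n -addnn -addn1 leq_add ?expn_gt0 //.
by rewrite (leq_trans (max_card _)) // card_ord.
Qed.

Lemma heightS n (s t : layer n) : s \subset t -> height t <= height s.
Proof.
move=> st; apply: height_le; apply: leq_up_log.
by rewrite ltnS; exact: subset_leq_card.
Qed.

Lemma height0 n : height (finset.set0 : layer n) = 1.
Proof. by rewrite /height cards0 up_log1 mul0r subr0. Qed.

Lemma heightT n : height (finset.setTfor 'I_(2 ^ n) : layer n) = 0.
Proof.
apply/eqP; rewrite eq_le height_ge0 andbT subr_le0 ler_pdivlMr ?ltr0n // mul1r.
rewrite ler_nat cardsT card_ord.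
rewrite (@up_log_eq 2 n) // ltnSn expnS mul2n -addnn -addn1.
by rewrite leq_add ?expn_gt0.
Qed.

Lemma heightU n (s t : layer n) :
  Num.min (height s) (height t) - n.+1%:R^-1 <= height (s :|: t).
Proof.
set k := maxn (up_log 2 #|s|.+1) (up_log 2 #|t|.+1).
apply: le_trans (height_le (up_log2_setU s t)).
rewrite -/k -[k.+1%:R]natr1 mulrDl mul1r opprD addrA lerB //.
rewrite /k /height; case: (leqP (up_log 2 #|s|.+1) (up_log 2 #|t|.+1)) => st.
  by rewrite ge_min lexx orbT.
by rewrite ge_min lexx.
Qed.

(** * The pairs of a family of sets and a height, with their meet *)

Definition layers : topologicalType :=
  prod_topology (fun n => discrete_topology (layer n)).

Definition ambient : topologicalType := (layers * R)%type.

Definition below (p : ambient) :=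
  0 <= p.2 /\ forall n, p.2 <= height (p.1 n : layer n).

Definition nonlawson : Type := initial_topology
  (fun x : set_type [set p | below p] => val x : ambient).
HB.instance Definition _ := Topological.on nonlawson.

Definition pt (a : forall n, layer n) (c : R) (h : below (a, c)) : nonlawson :=
  SigSub (mem_set h).
Definition part (x : nonlawson) n : layer n :=
  (val (x : set_type [set p | below p])).1 n.
Definition ht (x : nonlawson) : R := (val (x : set_type [set p | below p])).2.

Lemma ht_ge0 x : 0 <= ht x.
Proof. by have [] := set_valP (x : set_type [set p | below p]). Qed.

Lemma ht_le x n : ht x <= height (part x n).
Proof. by have [_] := set_valP (x : set_type [set p | below p]). Qed.

Lemma nonlawson_eq x y :
  (forall n, part x n = part y n) -> ht x = ht y -> x = y.
Proof.
case: x y => [[a c] ?] [[b d] ?] ab cd; apply: val_inj => /=; congr pair => //.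
exact: functional_extensionality_dep.
Qed.

(** The height of a meet is an infimum, handled through its lower bounds; the semilattice laws
    compare these. *)
Lemma le_ext (x y : R) : (forall r, r <= x <-> r <= y) -> x = y.
Proof. by move=> xy; apply/le_anti/andP; split; apply/xy. Qed.

(** This is the infimum of [c] and all the [height (a n)], as the supremum of their lower bounds; 0
    is one of these when [0 <= c]. *)
Definition cap (a : forall n, layer n) (c : R) :=
  sup [set r | r <= c /\ forall n, r <= height (a n)].

Lemma le_cap a c r : 0 <= c ->
  r <= cap a c <-> r <= c /\ forall n, r <= height (a n).
Proof.
move=> c0; set S := [set r | r <= c /\ forall n, r <= height (a n)].
have S0 : S 0 by split=> // n; exact: height_ge0.
have Sc : ubound S c by move=> s [].
have hS : has_sup S by split; [exists 0|exists c].
split=> [rS|rS]; last by apply: ub_le_sup => //; exists c.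
split=> [|n]; apply: le_trans rS _.
  by apply: ge_sup => //; exists 0.
by apply: ge_sup; [exists 0|move=> s [_]].
Qed.

Lemma cap_below a c : 0 <= c -> below (a, cap a c).
Proof.
move=> c0; split=> [|n] /=.
  by apply/le_cap => //; split=> // n; exact: height_ge0.
by have [_] := (le_cap a (cap a c) c0).1 (lexx _).
Qed.

Lemma minht_ge0 x y : 0 <= Num.min (ht x) (ht y).
Proof. by rewrite le_min !ht_ge0. Qed.

Definition nl_meet x y : nonlawson :=
  pt (cap_below (fun n => part x n :|: part y n) (minht_ge0 x y)).

Lemma part_meet x y n : part (nl_meet x y) n = part x n :|: part y n.
Proof. by []. Qed.

Lemma le_ht_meet x y r : r <= ht (nl_meet x y) <->
  [/\ r <= ht x, r <= ht y & forall n, r <= height (part x n :|: part y n)].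
Proof.
rewrite /ht /= -/(ht _) le_cap ?minht_ge0 // le_min.
by split=> [[/andP[]]|[-> ->]].
Qed.

Lemma one_below : below ((fun n => finset.set0 : layer n), 1).
Proof. by split=> [|n]; rewrite /= ?height0. Qed.

Definition nl_one := pt one_below.

(** Either bracketing is bounded by the three heights and the triple unions; a pairwise union, being
    a subset of the triple one, is at least as high. *)
Fact nl_meetA : associative nl_meet.
Proof.
move=> x y z; apply: nonlawson_eq => [n|].
  by rewrite !part_meet finset.setUA.
apply: le_ext => r; split=> /le_ht_meet.
  move=> [rx /le_ht_meet[ry rz ryz] rxyz]; apply/le_ht_meet; split=> // [|n].
    apply/le_ht_meet; split=> // n; apply: le_trans (rxyz n) (heightS _).
    by rewrite part_meet finset.setUA finset.subsetUl.
  by rewrite part_meet -finset.setUA -part_meet.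
move=> [/le_ht_meet[rx ry rxy] rz rxyz]; apply/le_ht_meet; split=> // [|n].
  apply/le_ht_meet; split=> // n; apply: le_trans (rxyz n) (heightS _).
  by rewrite part_meet -finset.setUA finset.subsetUr.
by rewrite part_meet finset.setUA -part_meet.
Qed.

Fact nl_meetC : commutative nl_meet.
Proof.
move=> x y; apply: nonlawson_eq => [n|].
  by rewrite !part_meet finset.setUC.
by apply: le_ext => r; split=> /le_ht_meet[? ? h]; apply/le_ht_meet;
  split=> // n; rewrite finset.setUC.
Qed.

Fact nl_meetxx : idempotent_op nl_meet.
Proof.
move=> x; apply: nonlawson_eq => [n|].
  by rewrite !part_meet finset.setUid.
apply: le_ext => r; split=> [/le_ht_meet[]//|rx].
apply/le_ht_meet; split=> // n.
by rewrite finset.setUid; exact: le_trans rx (ht_le _ _).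
Qed.

Lemma ht_le1 x : ht x <= 1.
Proof.
by apply: le_trans (ht_le x 0) _; rewrite -(height0 0) heightS ?finset.sub0set.
Qed.

Fact nl_meet1x : left_id nl_one nl_meet.
Proof.
move=> x; apply: nonlawson_eq => [n|]; first by rewrite !part_meet finset.set0U.
apply: le_ext => r; split=> [/le_ht_meet[]//|rx].
apply/le_ht_meet; split=> // [|n].
  exact: le_trans rx (ht_le1 x).
by rewrite finset.set0U; exact: le_trans rx (ht_le _ _).
Qed.

HB.instance Definition _ := isUnitalMeetSemilattice.Build nonlawson
  nl_meetA nl_meetC nl_meetxx nl_meet1x.

(** * Continuity of the meet, compactness and separation *)

Lemma val_continuous :
  continuous
    ((fun x : set_type [set p | below p] => val x) : nonlawson -> ambient).
Proof. exact: initial_continuous. Qed.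

Lemma ht_continuous : continuous ht.
Proof.
move=> x; apply: (cvg_comp _ (snd : ambient -> R) (@val_continuous x)).
exact: cvg_snd.
Qed.

Lemma part_near x n : \forall y \near x, part y n = part x n.
Proof.
have : (fun y => part y n : discrete_topology (layer n)) @ x -->
    (part x n : discrete_topology (layer n)).
  apply: (cvg_comp _ (fun p : ambient => p.1 n) (@val_continuous x)).
  apply: (cvg_comp (fst : ambient -> _) (fun p : layers => p n)).
    exact: cvg_fst.
  exact: (@proj_continuous nat (fun n => discrete_topology (layer n)) n).
move=> /(_ [set part x n]); apply.
by rewrite nbhs_principalE; apply/principal_filterP.
Qed.

Fact nl_meet_continuous :
  continuous (fun p : nonlawson * nonlawson => smeet p.1 p.2).
Proof.
apply: continuous_comp_initial => -[x y].
have near1 (P : set nonlawson) : nbhs x P -> \forall p \near (x, y), P p.1.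
  by move=> xP; apply: cvg_fst xP.
have near2 (P : set nonlawson) : nbhs y P -> \forall p \near (x, y), P p.2.
  by move=> yP; apply: cvg_snd yP.
have cp : (fun p : nonlawson * nonlawson => part (smeet p.1 p.2) : layers)
    @ (x, y) --> (part (smeet x y) : layers).
  apply: prod_cvg => n A; rewrite nbhs_principalE => /principal_filterP Axy.
  apply: filterS (filterI (near1 _ (part_near x n)) (near2 _ (part_near y n))).
  by move=> p [px py] /=; rewrite part_meet px py.
have ch : (fun p : nonlawson * nonlawson => ht (smeet p.1 p.2)) @ (x, y)
    --> ht (smeet x y).
  apply/cvgrPdist_le => e e0; have e2 : 0 < e / 2 by rewrite divr_gt0.
  (* From layer [N] on, a union loses less than [e / 2] of height; the finitely many earlier parts
     are locally constant. *)
  have [N _ Ne] := near_infty_natSinv_lt (PosNum e2).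
  have nearh (z : nonlawson) : \forall z' \near z, `|ht z - ht z'| <= e / 2.
    by have /cvgrPdist_le := @ht_continuous z; exact.
  have nearp (z : nonlawson) :
      \forall z' \near z, forall n : 'I_N, part z' n = part z n.
    exact: (@filter_forall _ _ (fun (n : 'I_N) z' => part z' n = part z n)
      (nbhs z) _ (fun n => part_near z n)).
  apply: filterS (filterI (filterI (near1 _ (nearh x)) (near1 _ (nearp x)))
    (filterI (near2 _ (nearh y)) (near2 _ (nearp y)))).
  move=> [x' y'] [[/= hx px] [/= hy py]].
  (* A one-sided estimate suffices: its hypotheses are symmetric in the two pairs, so it is applied
     in both directions. *)
  have bound a b a' b' : `|ht a - ht a'| <= e / 2 -> `|ht b - ht b'| <= e / 2 ->
      (forall n : 'I_N, part a' n = part a n) ->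
      (forall n : 'I_N, part b' n = part b n) ->
      ht (smeet a b) - e <= ht (smeet a' b').
    rewrite !ler_distl => /andP[_ ha] /andP[_ hb] pa pb.
    have [ab_a ab_b ab_h] := (le_ht_meet a b (ht (smeet a b))).1 (lexx _).
    have ea : e = e / 2 + e / 2 by rewrite -splitr.
    apply/le_ht_meet; split=> [||n]; [lra|lra|].
    (* Before [N] the unions coincide. From [N] on, one [e / 2] pays for the union and the other for
       moving [a] and [b]. *)
    have [nN|Nn] := ltnP n N.
      have -> : part a' n = part a n := pa (Ordinal nN).
      have -> : part b' n = part b n := pb (Ordinal nN).
      by apply: le_trans (ab_h n); rewrite lerBlDr lerDl ltW.
    have en : n.+1%:R^-1 < e / 2 := Ne n Nn.
    apply: le_trans (heightU _ _); move: (n.+1%:R^-1) en => d en.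
    rewrite lerBrDr le_min; apply/andP; split.
      by apply: le_trans (ht_le a' n); lra.
    by apply: le_trans (ht_le b' n); lra.
  rewrite ler_distl; apply/andP; split; last first.
    by rewrite -lerBlDr; apply: bound.
  rewrite bound //; first by rewrite distrC.
  by rewrite distrC.
exact: (cvg_pair cp ch).
Qed.

HB.instance Definition _ :=
  PreTopologicalSemilattice_isTopologicalSemilattice.Build nonlawson
    nl_meet_continuous.

(** The space is cut out of the compact product of the finite layers and the unit interval by one
    closed condition for each layer and [0 <= p.2]. *)
Lemma nonlawson_compact : compact [set: nonlawson].
Proof.
apply: initial_compact.
have comp : compact ([set: layers] `*` `[0, 1]%classic : set ambient).
  apply: compact_setX; last exact: segment_compact.
  rewrite (_ : [set: _] =
      [set f | forall n, [set: discrete_topology (layer n)] (f n)]).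
    apply: (@tychonoff nat (fun n => discrete_topology (layer n))
      (fun=> setT)) => n.
    by apply: finite_compact; exact: (@finite_finset (layer n)).
  by apply/seteqP; split.
apply: subclosed_compact comp _; last first.
  by move=> _ [x _ <-]; split=> //=; rewrite in_itv /= -/(ht x) ht_ge0 ht_le1.
rewrite (_ : range _ = (snd : ambient -> R) @^-1` [set r | 0 <= r] `&`
    \bigcap_n ((fun p : ambient => height (p.1 n : layer n) - p.2)
      @^-1` [set r | 0 <= r])).
  have csnd : continuous (snd : ambient -> R) by move=> p; exact: cvg_snd.
  apply: closedI.
    by apply: preimage_closed => [p _|]; [exact: csnd|exact: closed_ge].
  apply: closed_bigI => n _; apply: preimage_closed; last exact: closed_ge.
  move=> p _; apply: cvgB; last exact: csnd.
  apply: (cvg_comp (fst : ambient -> layers)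
    (fun q : layers => height (q n : layer n))).
    exact: cvg_fst.
  apply: (cvg_comp (fun q : layers => q n)
    (@height n : discrete_topology (layer n) -> R)).
    exact: (@proj_continuous nat (fun n => discrete_topology (layer n)) n).
  move=> A /nbhs_singleton Ap.
  by rewrite nbhs_principalE; apply/principal_filterP.
apply/seteqP; split => [_ [x _ <-]|p [p0 pn]].
  by split=> [|n _ /=]; [exact: ht_ge0|rewrite subr_ge0; exact: ht_le].
have bp : below p by split=> // n; rewrite -subr_ge0; exact: pn.
by exists (SigSub (mem_set bp)).
Qed.

Lemma nonlawson_hausdorff : hausdorff_space nonlawson.
Proof.
apply: initial_hausdorff; first exact: val_inj.
apply: hausdorff_prod; last exact: norm_hausdorff.
by apply: hausdorff_product => n; exact: discrete_hausdorff.
Qed.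

End NonLawson.

(** * Failure of small semilattices at the top element *)

Section Spikes.
Variable R : realType.
Local Notation K := (nonlawson R).

Lemma spike_below n (s : layer n) :
  below ((fun m => dfwith (fun m => finset.set0 : layer m) n s m), height R s).
Proof.
split=> [|m] /=; first exact: height_ge0.
case: dfwithP => // m' _; rewrite height0 -(height0 R n).
by apply: heightS; exact: finset.sub0set.
Qed.

(** The largest admissible height is chosen: spikes over singletons then tend to [sone], and the
    meet of two spikes of one layer is again a spike. *)
Definition spike n (s : layer n) : K := pt (spike_below s).

Lemma spike_part n s m :
  part (@spike n s) m = dfwith (fun m => finset.set0 : layer m) n s m.
Proof. by []. Qed.

Lemma spikeU n (s t : layer n) : smeet (spike s) (spike t) = spike (s :|: t).
Proof.
apply: nonlawson_eq => [m|].
  rewrite part_meet !spike_part; case: (eqVneq n m) => [<-|nm].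
    by rewrite !dfwithin.
  by rewrite !dfwithout // finset.setU0.
apply: le_ext => r; split=> [/le_ht_meet[_ _ /(_ n)]|rst].
  by rewrite !spike_part !dfwithin.
apply/le_ht_meet; split=> [||m].
- by apply: le_trans rst (heightS _ _); exact: finset.subsetUl.
- by apply: le_trans rst (heightS _ _); exact: finset.subsetUr.
rewrite !spike_part; case: (eqVneq n m) => [<-|nm]; first by rewrite !dfwithin.
rewrite !dfwithout // finset.setU0 height0.
by apply: le_trans rst _; rewrite -(height0 R n) heightS ?finset.sub0set.
Qed.

Lemma spike_near (V : set K) : nbhs (sone : K) V ->
  \forall n \near \oo, forall s : layer n, (#|s| <= 1)%N -> V (spike s).
Proof.
move=> V1; pose bad m (s : layer m) := (#|s| <= 1)%N /\ ~ V (spike s).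
(* A counterexample is chosen in each layer that has one, so convergence of this single sequence
   gives the claim for all [s] at once. *)
have goodP : forall m, exists s : layer m,
    (#|s| <= 1)%N /\ (V (spike s) -> forall t, ~ bad m t).
  move=> m; have [[t bt]|nb] := pselect (exists t, bad m t).
    by exists t; case: bt.
  exists finset.set0; split=> [|_ t bt]; first by rewrite cards0.
  by apply: nb; exists t.
pose s m := projT1 (cid (goodP m)).
have sP m : (#|s m| <= 1)%N /\ (V (spike (s m)) -> forall t, ~ bad m t) :=
  projT2 (cid (goodP m)).
suff : (fun m => spike (s m)) @ \oo --> (sone : K).
  move=> spV; have Vs : \forall m \near \oo, V (spike (s m)) := spV V V1.
  apply: filterS Vs => m Vsm t t1; apply: contrapT => nVt.
  by apply: ((sP m).2 Vsm t).
have cp : (fun m => part (spike (s m)) : layers) @ \oo -->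
    (part (sone : K) : layers).
  apply: prod_cvg => n A; rewrite nbhs_principalE => /principal_filterP A0.
  exists n.+1 => // m nm; rewrite /= /part /= dfwithout //.
  by rewrite gtn_eqF.
suff ch : (fun m => ht (spike (s m))) @ \oo --> ht (sone : K).
  by apply: cvg_initial; exact: (cvg_pair cp ch).
apply/cvgrPdist_le => e e0.
have [N _ Ne] := near_infty_natSinv_lt (PosNum e0).
exists N => // m Nm /=; have mE : m.+1%:R^-1 < e := Ne m Nm.
have hl : 1 - 1 / m.+1%:R <= height R (s m).
  apply: (@height_le R m (s m) 1%N); apply: up_log_min => //.
  by rewrite expn1 ltnS; exact: (sP m).1.
have hr := ht_le1 (spike (s m)).
rewrite ger0_norm ?subr_ge0 // lerBlDr -lerBlDl.
by apply: le_trans hl; rewrite lerD2l lerN2 div1r ltW.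
Qed.

(** A submonoid [W] around the fibre of [f] over [sone] contains the lifted singleton spikes of a
    late layer, hence the lift of their meet, which has height 0. *)
Theorem nonlawson_no_zero_dim (T : topologicalSemilatticeType) (f : T -> K)
    (g : K -> T) :
  SBt T -> continuous f -> semilattice_hom f -> semilattice_hom g ->
  f \o g <> id.
Proof.
move=> zT cf hf hg fg; have [[cT _] _] := zT.
have fgE x : f (g x) = x by rewrite -[RHS]/(id x) -fg.
have hK := @nonlawson_hausdorff R.
pose C := [set x | f x = sone].
have clC : closed C by apply: closed_equalizer => // x; exact: cvg_cst.
have CM x y : C x -> C y -> C (smeet x y).
  by rewrite /C /= hf.1 => -> ->; rewrite smeetxx.
have C0 : C !=set0 by exists sone; exact: hf.2.
have [e Ce eC] := Sct_least zT.1 clC C0 CM.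
have fhalf : nbhs e (f @^-1` [set x | 1 / 2 < ht x]).
  have ht1 : nbhs (ht (sone : K)) [set r : R | 1 / 2 < r].
    by apply: open_nbhs_nbhs; split; [exact: open_gt|rewrite /ht /=; lra].
  by apply: cf; rewrite Ce; exact: (@ht_continuous R sone _ ht1).
have [W [CW WM Whalf]] := SBt_small_submonoid zT Ce eC fhalf.
have [n gW] : exists n, forall s : layer n, (#|s| <= 1)%N -> W (g (spike s)).
  (* By compactness of [T] it is enough to argue near each [t]: inside the fibre [W] is a
     neighbourhood; outside it, [f t] is separated from late spikes. *)
  suff : \forall n \near \oo, [set: T] `<=` (fun t =>
      forall s : layer n, (#|s| <= 1)%N -> f t = spike s -> W t).
    by case=> n _ /(_ n (leqnn n)) H; exists n => s s1; exact: (H _ I s).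
  have /compact_near_coveringP := cT; apply=> t _.
  have [Ct|nCt] := pselect (C t).
    exists (W, setT) => /=; first by split; [exact: CW|exact: filterT].
    by move=> [x m] [].
  move: hK; rewrite open_hausdorff => /(_ (f t) sone)[|[A B]] /=.
    exact/eqP.
  move=> [/set_mem At /set_mem B1] [oA oB /eqP AB0].
  exists (f @^-1` A,
    [set m | forall s : layer m, (#|s| <= 1)%N -> B (spike s)]) => /=.
    split; first by apply: cf; exact: open_nbhs_nbhs.
    exact: spike_near (open_nbhs_nbhs (conj oB B1)).
  move=> [x m] /= [Ax Bm] s s1 fx; have : (A `&` B) (f x).
    by split=> //; rewrite fx; exact: Bm.
  by rewrite AB0.
(* The full layer is built one singleton at a time, using only that [W] is closed under meets. *)
have gWk k : W (g (spike [set i : 'I_(2 ^ n) | (i < k)%N]%SET)).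
  elim: k => [|k IHk].
    rewrite (_ : finset _ = finset.set0); first by apply: gW; rewrite cards0.
    by apply/setP => i; rewrite !inE.
  rewrite (_ : finset _ = [set i : 'I_(2 ^ n) | (i < k)%N]%SET :|:
    [set i : 'I_(2 ^ n) | val i == k]%SET); last first.
    by apply/setP => i; rewrite !inE ltnS leq_eqVlt orbC.
  rewrite -spikeU hg.1; apply: WM => //; apply: gW.
  apply/card_le1_eqP => i j; rewrite !inE => /eqP ik /eqP jk.
  by apply: val_inj; rewrite ik jk.
(* As [f e] is [sone], meeting with [e] does not change the image under [f]: height 0 would exceed
   [1 / 2]. *)
have := Whalf _ (gWk (2 ^ n)%N).
rewrite /= hf.1 Ce fgE smeetC smeet1x.
rewrite (_ : finset _ = finset.setTfor 'I_(2 ^ n)).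
  rewrite /ht /= heightT; lra.
by apply/setP => i; rewrite !inE ltn_ord.
Qed.

End Spikes.

Theorem theorem4p4 :
  exists A : unitalMeetSemilatticeType,
  exists (b : topologicalSemilatticeType) (iota : A -> b),
  exists (b0 : topologicalSemilatticeType) (iota0 : A -> b0),
    [/\ bohr_compactification iota,
        zero_dim_bohr_compactification iota0
      & ~ isomorphic_under iota iota0].
Proof.
pose K : topologicalSemilatticeType := nonlawson Rdefinitions.R.
exists K.
have [b [iota bP]] := bohr_exists K.
have [b0 [iota0 b0P]] := zero_dim_bohr_exists K.
exists b, iota, b0, iota0; split=> // -[h [k [_ [ck hk] [hK _] hi]]].
(* The identity of [K] extends to [f] on [b]; composed with the isomorphism [k] it becomes a
   continuous left inverse of [iota0] on [b0]. *)
have [_ _ _ /(_ K)] := bP.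
move=> /(_ (conj (@nonlawson_compact _) (@nonlawson_hausdorff _))).
move=> /(_ id (conj (fun _ _ => erefl) erefl)) [f [[cf hf fi] _]].
have [zb0 [hi0 _] _ _] := b0P.
apply: (@nonlawson_no_zero_dim _ b0 (f \o k) iota0) => //.
- by move=> x; apply: continuous_comp; [exact: ck|exact: cf].
- split=> [x y|]; first by rewrite /= hk.1 hf.1.
  by rewrite /= hk.2 hf.2.
- by apply/funext => x /=; rewrite -hi /= hK -[LHS]/((f \o iota) x) fi.
Qed.
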